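(* Let $G$ be a finite group, set $\epsilon(G)=(\zeta^G(2)-1)^{1/4}$, and for $g\in G$ let $N(g)=|\{(x,y)\in G\times G: x^{-1}y^{-1}xy=g\}|$. Then there is a subset $S\subseteq G$ such that: (i) $|S|\ge(1-\epsilon(G))|G|$; (ii) $(1-\epsilon(G))|G|\le N(g)\le(1+\epsilon(G))|G|$ for all $g\in S$.
   Context: For a finite group $G$, $\mathrm{Irr}(G)$ denotes the set of complex irreducible characters of $G$, and $\zeta^G(s)=\sum_{\chi\in\mathrm{Irr}(G)}\chi(1)^{-s}$ for real $s$. *)

(* Defs.v *)
From mathcomp Require Import all_boot all_order all_algebra all_fingroup all_field.
From mathcomp Require Import all_character.
From mathcomp Require Import reals exp.

Set Implicit Arguments.
Unset Strict Implicit.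
Unset Printing Implicit Defensive.

Import GroupScope GRing.Theory Num.Theory.
Local Open Scope ring_scope.

(* MathComp's irreducible complex characters take values in algC, so a degree
   is read back as a natural number before it is raised to a real power. *)
Definition irr_deg (gT : finGroupType) (G : {group gT}) (i : Iirr G) : nat :=
  Num.truncn ('chi[G]_i 1%g).

Lemma irr_degE (gT : finGroupType) (G : {group gT}) (i : Iirr G) :
  (irr_deg i)%:R = 'chi[G]_i 1%g.
Proof. by rewrite /irr_deg truncnK // Cnat_irr1. Qed.

Definition witten_zeta (R : realType) (gT : finGroupType) (G : {group gT})
    (s : R) : R :=
  \sum_(i : Iirr G) (irr_deg i)%:R `^ (- s).

Definition comm_eps (R : realType) (gT : finGroupType) (G : {group gT}) : R :=
  (witten_zeta G (2 : R) - 1) `^ (4^-1).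

Definition comm_count (gT : finGroupType) (G : {group gT}) (g : gT) : nat :=
  #|[set p : gT * gT | [&& p.1 \in G, p.2 \in G &
      (p.1^-1 * p.2^-1 * p.1 * p.2)%g == g]]|.

(* Main.v *)
(* The Fourier coefficient of N at an irreducible character chi is |G| / chi(1)
   (Frobenius), so the trivial character contributes the constant |G|, and
   Parseval gives \sum_(g in G) (N(g) - |G|)^2 = |G|^3 (zeta^G(2) - 1)
   = |G|^3 eps^4. By Chebyshev at most eps^2 |G| elements g satisfy
   |N(g) - |G|| > eps |G|, and eps^2 <= eps when eps < 1; for eps >= 1 the
   bound on the size of S is vacuous. Chebyshev divides by eps, so eps = 0 is
   treated apart: then N is constant on G. *)
Require Import Defs.
From mathcomp Require Import all_boot all_order all_algebra all_fingroup all_field.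
From mathcomp Require Import all_character.
From mathcomp Require Import reals exp ring.

Local Open Scope ring_scope.

Import Order.TTheory GRing.Theory Num.Theory.

(* Both sides are class functions of b; their inner products with the irreducible
   characters agree by the generalized orthogonality relation. *)
Lemma sum_irr_mulJ (gT : finGroupType) (G : {group gT}) (i : Iirr G) (a b : gT) :
    a \in G -> b \in G ->
  \sum_(y in G) 'chi_i (a * b ^ y)%g
    = #|G|%:R * 'chi_i a * 'chi_i b / 'chi_i 1%g.
Proof.
move=> aG bG; pose h (z : gT) : algC := \sum_(y in G) 'chi_i (a * z ^ y)%g.
have hP : is_class_fun <<G>>%g (finfun h).
  rewrite genGid; apply: intro_class_fun => [x y xG yG | x xG].
    rewrite /h [RHS](reindex_inj (mulgI y)) /=; apply: eq_big => z.
      by rewrite groupMl.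
    by rewrite conjgM.
  rewrite /h big1 // => y yG; rewrite cfun0 //.
  by rewrite groupMl // groupJr.
pose H : 'CF(G) := Cfun 0 hP.
have HE x : H x = h x by rewrite cfunElock.
have Hj j : '[H, 'chi_j] = #|G|%:R * ((i == j)%:R * ('chi_i a / 'chi_i 1%g)).
  rewrite cfdotE -generalized_orthogonality_relation mulrCA; congr (_ * _).
  under eq_bigr => x xG do rewrite HE mulr_suml.
  (* Every [y] contributes the same amount: replacing [x] by [x ^ y^-1] removes the conjugation and
     leaves the value of ['chi_j] unchanged. *)
  rewrite exchange_big /= -sum1_card natr_sum mulr_suml; apply: eq_bigr => y yG.
  rewrite mul1r (reindex_inj (conjg_inj y^-1)%g) /=; apply: eq_big => x.
    by rewrite groupJr ?groupV.
  rewrite groupJr ?groupV // => xG; rewrite conjgKV cfunJ ?groupV // irr_inv.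
  (* Conjugating by [a] turns [a * x] into [x * a], the order used in the orthogonality relation. *)
  congr (_ * _); rewrite -[LHS](cfunJ _ _ aG) conjgE.
  by rewrite !mulgA mulVg mul1g.
have -> : \sum_(y in G) 'chi_i (a * b ^ y)%g = H b by rewrite HE.
rewrite [H]cfun_sum_cfdot sum_cfunE (bigD1 i) //= big1 ?addr0 => [|j jNi].
  by rewrite cfunE Hj eqxx mul1r !mulrA mulrAC.
by rewrite cfunE Hj eq_sym (negPf jNi) mul0r mulr0 mul0r.
Qed.

(** Conjugating both entries of a pair conjugates its commutator, which gives a bijection between
    the fibres; off [G] the fibres are empty. *)
Lemma comm_count_class_fun (gT : finGroupType) (G : {group gT}) :
  is_class_fun <<G>>%g (finfun (fun g => (comm_count G g)%:R : algC)).
Proof.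
rewrite genGid; apply: intro_class_fun => [x y xG yG | x xNG].
  congr (_ %:R).
  pose f (p : gT * gT) := (p.1 ^ y, p.2 ^ y)%g.
  have fI : injective f by move=> [u v] [u' v'] [/conjg_inj-> /conjg_inj->].
  rewrite -[RHS](card_imset _ fI); apply: eq_card => -[u v]; apply/idP/imsetP.
    rewrite inE /= => /and3P[uG vG /eqP e].
    exists (u ^ y^-1, v ^ y^-1)%g; last by rewrite /f /= !conjgKV.
    by rewrite inE /= !groupJr ?groupV // uG vG -!conjVg -!conjMg e conjgK eqxx.
  case=> -[u' v']; rewrite inE /= => /and3P[uG vG /eqP e] [-> ->].
  by rewrite inE /= !groupJr // uG vG -!conjVg -!conjMg e eqxx.
rewrite /comm_count (_ : [set _ | _] = set0) ?cards0 //.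
apply/setP => -[u v]; rewrite !inE /=; apply/and3P => -[uG vG /eqP e].
by case/negP: xNG; rewrite -e !groupM ?groupV.
Qed.

Definition comm_cfun (gT : finGroupType) (G : {group gT}) : 'CF(G) :=
  Cfun 0 (comm_count_class_fun gT G).

Lemma comm_cfunE (gT : finGroupType) (G : {group gT}) (g : gT) :
  comm_cfun gT G g = (comm_count G g)%:R.
Proof. by rewrite cfunElock. Qed.

(** The commutator of [x] and [y] is [x^-1 * x ^ y], so [sum_irr_mulJ] with [a = x^-1] and [b = x]
    evaluates the sum over [y]; the sum over [x] is then the norm of ['chi_i], which is 1. *)
Lemma cfdot_comm_irr (gT : finGroupType) (G : {group gT}) (i : Iirr G) :
  '[comm_cfun gT G, 'chi_i] = #|G|%:R / 'chi_i 1%g.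
Proof.
rewrite cfdotE.
have sumN : \sum_(g in G) comm_cfun gT G g * ('chi_i g)^*
    = \sum_(x in G) \sum_(y in G) ('chi_i (x^-1 * x ^ y)%g)^*.
  (* Pairs are grouped by the value [g] of their commutator. *)
  rewrite pair_big /= [RHS](partition_big
    (fun p : gT * gT => p.1^-1 * p.1 ^ p.2)%g (mem G)) /= => [|p]; last first.
    by case/andP=> xG yG; rewrite groupM ?groupV ?groupJ.
  apply: eq_bigr => g gG; rewrite comm_cfunE.
  rewrite (eq_bigr (fun=> ('chi_i g)^*)) => [|p /andP[_ /eqP-> //]].
  rewrite sumr_const mulr_natl; congr (_ *+ _).
  by apply: eq_card => p; rewrite !inE unfold_in /= conjgE !mulgA andbA.
have n1 : ('chi_i 1%g)^* = 'chi_i 1%g by rewrite conj_natr ?Cnat_irr1.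
rewrite {}sumN (eq_bigr (fun x => 'chi_i x * ('chi_i x)^* * (#|G|%:R / 'chi_i 1%g))).
  by rewrite -mulr_suml mulrA -cfdotE cfdot_irr eqxx mul1r.
move=> x xG; rewrite -rmorph_sum sum_irr_mulJ ?groupV // irr_inv.
rewrite !rmorphM /= fmorphV /= conjCK n1 rmorph_nat !mulrA; congr (_ / _).
by rewrite -mulrA mulrC.
Qed.

Lemma sum_comm_count_dev (F : numFieldType) (gT : finGroupType) (G : {group gT}) :
  \sum_(g in G) ((comm_count G g)%:R - #|G|%:R) ^+ 2
    = #|G|%:R ^+ 3 * (\sum_(i : Iirr G) (irr_deg i)%:R ^- 2 - 1) :> F.
Proof.
(* Both sides are images of rationals, and the equality of these rationals can be
   tested in algC, where characters live. *)
pose A : rat := \sum_(g in G) ((comm_count G g)%:R - #|G|%:R) ^+ 2.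
pose B : rat := #|G|%:R ^+ 3 * (\sum_(i : Iirr G) (irr_deg i)%:R ^- 2 - 1).
have ratrA (K : numFieldType) :
    ratr A = \sum_(g in G) ((comm_count G g)%:R - #|G|%:R) ^+ 2 :> K.
  rewrite rmorph_sum; apply: eq_bigr => g _.
  by rewrite rmorphXn rmorphB /= !ratr_nat.
have ratrB (K : numFieldType) : ratr B
    = #|G|%:R ^+ 3 * (\sum_(i : Iirr G) (irr_deg i)%:R ^- 2 - 1) :> K.
  rewrite rmorphM rmorphXn rmorphB rmorph1 rmorph_sum /= ratr_nat.
  congr (_ * (_ - 1)); apply: eq_bigr => i _.
  by rewrite fmorphV rmorphXn /= ratr_nat.
rewrite -ratrA -ratrB; congr (ratr _); apply: (@fmorph_inj _ _ (@ratr algC)).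
rewrite [LHS]ratrA [RHS]ratrB.
(* Subtracting the constant [#|G|] removes exactly the component of the count along the trivial
   character. *)
pose f := comm_cfun gT G - #|G|%:R *: 'chi_0.
have fE i : '[f, 'chi_i] = if i == 0 then 0 else #|G|%:R / 'chi_i 1%g.
  rewrite cfdotBl cfdotZl cfdot_irr cfdot_comm_irr [0 == i]eq_sym.
  case: eqP => [->|_]; last by rewrite mulr0 subr0.
  by rewrite irr0 cfun11 divr1 mulr1 subrr.
have n0 : #|G|%:R != 0 :> algC by apply: neq0CG.
have : '[f] = #|G|%:R ^+ 2 * (\sum_(i : Iirr G) (irr_deg i)%:R ^- 2 - 1).
  rewrite cfdot_sum_irr (bigD1 0) //= fE eqxx mul0r add0r.
  rewrite [in RHS](bigD1 0) //= irr_degE irr0 cfun11 expr1n invr1 addrAC subrr add0r.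
  rewrite mulr_sumr; apply: eq_bigr => i /negPf i0.
  rewrite fE i0 irr_degE conj_Creal; last first.
    by rewrite rpred_div ?rpred_nat ?(Rreal_nat (Cnat_irr1 _)).
  by rewrite -expr2 exprMn exprVn.
(* The factor [#|G|^-1] in the norm moves across and raises the square to a cube. *)
rewrite (cfnormE (cfun_onG _)) => /(canRL (mulVKf n0)).
rewrite mulrA -exprS => <-; apply: eq_bigr => g gG.
rewrite !cfunE irr0 cfun1E gG mulr1 real_normK //.
by rewrite rpredB ?rpred_nat.
Qed.

(** The fourth root is undone because its argument is nonnegative: the trivial character contributes
    1 to the zeta sum, which cancels the [- 1]. *)
Lemma comm_eps_expr4 (R : realType) (gT : finGroupType) (G : {group gT}) :
  comm_eps R G ^+ 4 = \sum_(i : Iirr G) (irr_deg i)%:R ^- 2 - 1.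
Proof.
have zetaE : witten_zeta G (2 : R) = \sum_(i : Iirr G) (irr_deg i)%:R ^- 2.
  by apply: eq_bigr => i _; rewrite powR_invn.
rewrite /comm_eps zetaE -powR_mulrn ?powR_ge0 // -powRrM mulVf ?pnatr_eq0 //.
rewrite powRr1 // (bigD1 0) //= /irr_deg irr0 cfun11 truncn1 expr1n invr1.
by rewrite addrAC subrr add0r sumr_ge0 // => i _; rewrite invr_ge0 exprn_ge0.
Qed.

Theorem theorem1p3 (R : realType) (gT : finGroupType) (G : {group gT}) :
  exists S : {set gT},
    [/\ S \subset G,
        (1 - comm_eps R G) * #|G|%:R <= (#|S|%:R : R)
      & forall g : gT, g \in S ->
          (1 - comm_eps R G) * #|G|%:R <= (comm_count G g)%:R
            <= (1 + comm_eps R G) * #|G|%:R].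
Proof.
set e := comm_eps R G; pose n : R := #|G|%:R.
have n_gt0 : 0 < n by rewrite ltr0n cardG_gt0.
pose dev g : R := (comm_count G g)%:R - n.
pose S := [set g in G | `|dev g| <= e * n].
have sSG : S \subset G by apply/subsetP => g; rewrite inE => /andP[].
exists S; split=> //.
- have [e_ge1|e_lt1] := leP 1 e.
    by rewrite (le_trans _ (ler0n _ _)) // mulr_le0_ge0 ?subr_le0 // ltW.
  have sum_dev : \sum_(g in G) (dev g) ^+ 2 = n ^+ 3 * e ^+ 4.
    by rewrite sum_comm_count_dev comm_eps_expr4.
  have cardS : n = #|S|%:R + #|G :\: S|%:R.
    by rewrite /n -natrD -(cardsID S G) (setIidPr sSG).
  (* It remains to bound the number of exceptional elements, [#|G :\: S|], by [e * n]. *)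
  rewrite -/n mulrBl mul1r lerBlDr {1}cardS lerD2l.
  have [e0|e_neq0] := eqVneq e 0.
    rewrite e0 mul0r lern0 cards_eq0; apply/eqP/setP => g; rewrite !inE.
    have /psumr_eq0P dev0 : \sum_(g in G) (dev g) ^+ 2 = 0.
      by rewrite sum_dev e0 expr0n mulr0.
    apply/andP => -[/negP gS gG]; case: gS.
    rewrite gG e0 mul0r normr_le0 -sqrf_eq0 dev0 ?eqxx // => h _.
    by rewrite real_exprn_even_ge0 ?num_real.
  have e_gt0 : 0 < e by rewrite lt_def e_neq0 powR_ge0.
  have en_gt0 : 0 < e * n by rewrite mulr_gt0.
  suff : (e * n) ^+ 2 * #|G :\: S|%:R <= n ^+ 3 * e ^+ 4.
    have -> : n ^+ 3 * e ^+ 4 = (e * n) ^+ 2 * (e ^+ 2 * n) by ring.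
    rewrite ler_pM2l ?exprn_gt0 // => /le_trans-> //.
    by rewrite ler_pM2r // expr2 ger_pMl // ltW.
  (* The terms over [S] are dropped; each remaining term is at least [(e * n) ^+ 2]. *)
  rewrite -sum_dev (big_setID S) /= ler_wpDl ?sumr_ge0 // => [g _|].
    exact: sqr_ge0.
  rewrite mulr_natr -sumr_const ler_sum // => g; rewrite !inE => /andP[gS gG].
  move: gS; rewrite gG -ltNge -[(dev g) ^+ 2]real_normK ?num_real // => /ltW.
  by move=> ?; rewrite ler_sqr ?nnegrE // ltW.
- move=> g; rewrite inE => /andP[_]; rewrite ler_norml /dev => /andP[lo hi].
  by rewrite mulrBl mulrDl !mul1r -lerBrDl lo -lerBlDl.
Qed.
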